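(* Let $(V;\mathfrak f,\mathfrak g)$ be a dual-modular instance normalized so that $\mathfrak f(V)=\mathfrak g(V)=1$. Every locally maximin allocation $(x,y)\in\mathcal B^{\ge}_{\mathfrak f}\times\mathcal B^{\le}_{\mathfrak g}$ is a minimizer of $\mathsf D(x'\|y')$ over $(x',y')\in\mathcal B^{\ge}_{\mathfrak f}\times\mathcal B^{\le}_{\mathfrak g}$ for every divergence $\mathsf D$ satisfying the data processing inequality.
   Context: $V$ is a finite ground set. A dual-modular instance $(V;\mathfrak f,\mathfrak g)$ consists of $\mathfrak f,\mathfrak g:2^V\to\mathbb R_{\ge0}$ with $\mathfrak f(\emptyset)=\mathfrak g(\emptyset)=0$, $\mathfrak f$ monotone and supermodular, $\mathfrak g$ submodular and strictly monotone ($A\subsetneq B\Rightarrow\mathfrak g(A)<\mathfrak g(B)$). For $x\in\mathbb R^V$, $x(S)=\sum_{u\in S}x_u$. $\mathcal B^{\ge}_{\mathfrak f}=\{x\in\mathbb R^V_{\ge0}:x(V)=\mathfrak f(V),\ x(S)\ge\mathfrak f(S)\ \forall S\}$, $\mathcal B^{\le}_{\mathfrak g}=\{y\in\mathbb R^V_{\ge0}:y(V)=\mathfrak g(V),\ y(S)\le\mathfrak g(S)\ \forall S\}$; with the normalization, elements of both sets are probability distributions on $V$. An allocation $(x,y)\in\mathcal B^{\ge}_{\mathfrak f}\times\mathcal B^{\le}_{\mathfrak g}$ is locally maximin if for every $\rho>0$, $S^{(\rho)}=\{v:x_v/y_v\ge\rho\}$ satisfies $x(S^{(\rho)})=\mathfrak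 f(S^{(\rho)})$ and $y(S^{(\rho)})=\mathfrak g(S^{(\rho)})$. A divergence is a function $\mathsf D$ of two distributions $P,Q$ on the same space with $\mathsf D(P\|Q)\ge0$ and equality iff $P=Q$. It satisfies the data processing inequality if for every stochastic transformation (channel) $T$ from the space to another space, $\mathsf D(T(P)\|T(Q))\le\mathsf D(P\|Q)$, where $T(P),T(Q)$ are the output distributions. *)

(* Defs.v *)
From HB Require Import structures.
From mathcomp Require Import all_boot all_order all_algebra.
From mathcomp Require Import reals constructive_ereal.

Set Implicit Arguments.
Unset Strict Implicit.
Unset Printing Implicit Defensive.

Import Order.TTheory GRing.Theory Num.Theory.
Local Open Scope ring_scope.

Definition set_monotone (R : realType) (V : finType) (h : {set V} -> R) : Prop :=
  forall A B : {set V}, A \subset B -> h A <= h B.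

Definition set_strictly_monotone (R : realType) (V : finType)
    (h : {set V} -> R) : Prop :=
  forall A B : {set V}, A \proper B -> h A < h B.

Definition supermodular (R : realType) (V : finType) (h : {set V} -> R) : Prop :=
  forall A B : {set V}, h A + h B <= h (A :|: B) + h (A :&: B).

Definition submodular (R : realType) (V : finType) (h : {set V} -> R) : Prop :=
  forall A B : {set V}, h (A :|: B) + h (A :&: B) <= h A + h B.

Record dual_modular (R : realType) (V : finType) (f g : {set V} -> R) : Prop :=
  DualModular {
    dual_modular_f_ge0 : forall A, 0 <= f A;
    dual_modular_g_ge0 : forall A, 0 <= g A;
    dual_modular_f0 : f set0 = 0;
    dual_modular_g0 : g set0 = 0;
    dual_modular_f_mono : set_monotone f;
    dual_modular_f_super : supermodular f;
    dual_modular_g_sub : submodular g;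
    dual_modular_g_mono : set_strictly_monotone g }.

Definition vsum (R : realType) (V : finType) (x : {ffun V -> R})
    (S : {set V}) : R := \sum_(u in S) x u.

Record base_ge (R : realType) (V : finType) (f : {set V} -> R)
    (x : {ffun V -> R}) : Prop := BaseGe {
  base_ge_ge0 : forall u, 0 <= x u;
  base_ge_total : vsum x [set: V] = f [set: V];
  base_ge_bound : forall S : {set V}, f S <= vsum x S }.

Record base_le (R : realType) (V : finType) (g : {set V} -> R)
    (y : {ffun V -> R}) : Prop := BaseLe {
  base_le_ge0 : forall u, 0 <= y u;
  base_le_total : vsum y [set: V] = g [set: V];
  base_le_bound : forall S : {set V}, vsum y S <= g S }.

(* Points of [base_le g] have positive coordinates when [g] is strictly
   monotone, so the convention [_ / 0 = 0] never matters in [level_set]. *)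
Lemma base_le_gt0 (R : realType) (V : finType) (g : {set V} -> R)
    (y : {ffun V -> R}) :
  set_strictly_monotone g -> base_le g y -> forall u, 0 < y u.
Proof.
move=> gm [_ yV yg] u.
have lt_g : g ([set: V] :\ u) < g [set: V] by apply/gm/properD1; rewrite inE.
have := yg ([set: V] :\ u); rewrite -(lerD2l (y u)).
rewrite -[X in X <= _ -> _](big_setD1 u) ?inE //= -/(vsum y [set: V]) yV.
by move=> /le_lt_trans le_lt; rewrite -(ltrD2r (g [set: V])) add0r le_lt ?ltrD2l.
Qed.

Definition level_set (R : realType) (V : finType) (x y : {ffun V -> R})
    (rho : R) : {set V} := [set v | rho <= x v / y v].

Definition locally_maximin (R : realType) (V : finType) (f g : {set V} -> R)
    (x y : {ffun V -> R}) : Prop :=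
  [/\ base_ge f x, base_le g y &
    forall rho : R, 0 < rho ->
      vsum x (level_set x y rho) = f (level_set x y rho) /\
      vsum y (level_set x y rho) = g (level_set x y rho)].

Definition is_fdist (R : realType) (T : finType) (p : {ffun T -> R}) : bool :=
  [forall t, 0 <= p t] && (\sum_t p t == 1).

Record fdist (R : realType) (T : finType) : Type := FDist {
  pmf :> {ffun T -> R};
  pmfP : is_fdist pmf }.

HB.instance Definition _ (R : realType) (T : finType) :=
  [isSub of fdist R T for @pmf R T].
HB.instance Definition _ (R : realType) (T : finType) :=
  [Choice of fdist R T by <:].

Lemma base_ge_is_fdist (R : realType) (V : finType) (f : {set V} -> R)
    (x : {ffun V -> R}) : f [set: V] = 1 -> base_ge f x -> is_fdist x.
Proof.
move=> fV [x0 xV _]; apply/andP; split; first exact/forallP.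
by rewrite -fV -xV /vsum; apply/eqP/eq_bigl => u; rewrite inE.
Qed.

Lemma base_le_is_fdist (R : realType) (V : finType) (g : {set V} -> R)
    (y : {ffun V -> R}) : g [set: V] = 1 -> base_le g y -> is_fdist y.
Proof.
move=> gV [y0 yV _]; apply/andP; split; first exact/forallP.
by rewrite -gV -yV /vsum; apply/eqP/eq_bigl => u; rewrite inE.
Qed.

Definition base_ge_fdist (R : realType) (V : finType) (f : {set V} -> R)
    (fV : f [set: V] = 1) (x : {ffun V -> R}) (hx : base_ge f x) : fdist R V :=
  FDist (base_ge_is_fdist fV hx).

Definition base_le_fdist (R : realType) (V : finType) (g : {set V} -> R)
    (gV : g [set: V] = 1) (y : {ffun V -> R}) (hy : base_le g y) : fdist R V :=
  FDist (base_le_is_fdist gV hy).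

(* A channel from [S] to [T] is a stochastic matrix, given by its rows
   [K s : fdist R T]. *)
Definition channel (R : realType) (S T : finType) : Type := S -> fdist R T.

Lemma channel_out_is_fdist (R : realType) (S T : finType) (K : channel R S T)
    (P : fdist R S) : is_fdist [ffun t => \sum_s P s * K s t].
Proof.
have /andP[/forallP P0 /eqP P1] := pmfP P.
apply/andP; split.
  apply/forallP => t; rewrite ffunE; apply: sumr_ge0 => s _.
  by apply: mulr_ge0 => //; have /andP[/forallP] := pmfP (K s).
apply/eqP; under eq_bigr do rewrite ffunE.
rewrite exchange_big -[RHS]P1; apply: eq_bigr => s _ /=.
by have /andP[_ /eqP K1] := pmfP (K s); rewrite -mulr_sumr K1 mulr1.
Qed.

Definition channel_out (R : realType) (S T : finType) (K : channel R S T)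
    (P : fdist R S) : fdist R T := FDist (channel_out_is_fdist K P).

(* Values lie in the extended reals because common divergences
   (e.g. Kullback-Leibler) may be infinite.  Only finite spaces are required:
   a divergence given on all measurable spaces restricts to one of these, and
   keeps the data processing inequality. *)
Definition dist_functional (R : realType) : Type :=
  forall T : finType, fdist R T -> fdist R T -> \bar R.

Record is_divergence (R : realType) (D : dist_functional R) : Prop :=
  IsDivergence {
    divergence_ge0 : forall (T : finType) (P Q : fdist R T), (0 <= D T P Q)%E;
    divergence_eq0 : forall (T : finType) (P Q : fdist R T),
      D T P Q = 0%E <-> P = Q }.

Definition data_processing (R : realType) (D : dist_functional R) : Prop :=
  forall (S T : finType) (K : channel R S T) (P Q : fdist R S),
    (D T (channel_out K P) (channel_out K Q) <= D S P Q)%E.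

(* Main.v *)
Require Import Defs.
From mathcomp Require Import all_boot all_order all_algebra.
From mathcomp Require Import reals constructive_ereal.
From mathcomp Require Import ring lra.

(** Let [S_1 < ... < S_n = V] be the level sets of [x / y].  Being tight at the
    maximin allocation, they satisfy [x'(S_i) >= x(S_i)] and
    [y'(S_i) <= y(S_i)].  In the plane with coordinates [(y, x)], the points
    [(y(S_i), x(S_i))] thus form a concave chain lying south-east of the points
    [(y'(S_i), x'(S_i))].  Cutting the upper chain successively along the edges
    of the lower one deforms the indicators of the [S_i] into a nested family
    of randomized tests [Phi_i] with [x'(Phi_i) = x(S_i)] and
    [y'(Phi_i) = y(S_i)].  Sending [u] to the [i]-th level with probability
    [Phi_(i+1) u - Phi_i u], and then resampling within that level
    proportionally to [y], is a channel mapping [(x', y')] to [(x, y)]; the data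
    processing inequality concludes. *)

Set Implicit Arguments.
Unset Strict Implicit.

Import Order.TTheory GRing.Theory Num.Theory.
Local Open Scope ring_scope.

(** * Randomized tests and their mixtures *)

(** For a distribution [p] and a test accepting [u] with probability [phi u], this is the acceptance
    probability under [p]. *)
Definition dot (R : realType) (V : finType) (p phi : V -> R) : R :=
  \sum_u p u * phi u.

Definition mix (R : realType) (V : finType) (t : R) (phi psi : V -> R) : V -> R :=
  fun u => (1 - t) * phi u + t * psi u.

Lemma dot_mix (R : realType) (V : finType) (p phi psi : V -> R) (t : R) :
  dot p (mix t phi psi) = (1 - t) * dot p phi + t * dot p psi.
Proof.
rewrite /dot /mix !mulr_sumr -big_split /=; apply: eq_bigr => u _; ring.
Qed.

Lemma dot_indicator (R : realType) (V : finType) (p : {ffun V -> R})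
    (S : {set V}) : dot p (fun u => (u \in S)%:R) = vsum p S.
Proof.
rewrite /dot /vsum [RHS]big_mkcond; apply: eq_bigr => u _ /=.
by case: (u \in S); rewrite ?mulr1 ?mulr0.
Qed.

Lemma mix_ge (R : realType) (V : finType) (t : R) (phi psi : V -> R) (u : V) :
  0 <= t -> phi u <= psi u -> phi u <= mix t phi psi u.
Proof. rewrite /mix => t0 le_u; nra. Qed.

Lemma mix_le (R : realType) (V : finType) (t : R) (phi psi : V -> R) (u : V) :
  t <= 1 -> phi u <= psi u -> mix t phi psi u <= psi u.
Proof. rewrite /mix => t1 le_u; nra. Qed.

Lemma mix_homo (R : realType) (V : finType) (s t : R) (phi psi : V -> R)
    (u : V) :
  s <= t -> phi u <= psi u -> mix s phi psi u <= mix t phi psi u.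
Proof. rewrite /mix => st le_u; nra. Qed.

Lemma convex_zero (R : realType) (a b : R) :
  a <= 0 -> 0 <= b -> exists t, [/\ 0 <= t, t <= 1 & (1 - t) * a + t * b = 0].
Proof.
move=> a0 b0; have [ab|/eqP nab] := eqVneq a b.
  by exists 0; split; [exact: lexx|exact: ler01|lra].
have d0 : 0 < b - a by rewrite subr_gt0 lt_neqAle; apply/andP; split; [exact/eqP|lra].
exists (- a / (b - a)); split; last by field; rewrite gt_eqF.
  by apply: divr_ge0; lra.
by rewrite ler_pdivrMr //; lra.
Qed.

(** * Cutting nested tests down to a concave chain *)

Lemma nested_le (R : realType) (V : finType) (Phi : nat -> V -> R) (m : nat) :
  (forall j u, (j < m)%N -> Phi j u <= Phi j.+1 u) ->
  forall i j u, (i <= j <= m)%N -> Phi i u <= Phi j u.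
Proof.
move=> nPhi i j u /andP[]; elim: j => [|j IH]; first by rewrite leqn0 => /eqP->.
rewrite leq_eqVlt => /orP[/eqP->//|ij jm].
by apply: le_trans (nPhi _ _ jm); apply: IH => //; apply: ltnW.
Qed.

(* One cut, along the line through the points [m] and [m + 1] of the chain
   [(beta, alpha)]: the tests from the crossing point [Psi] on are replaced by
   mixtures of [Psi] and the last test, whose values lie on that line. *)
Lemma cut_tests (R : realType) (V : finType) (p q : V -> R)
    (alpha beta : nat -> R) (rho : R) (m : nat) (Phi : nat -> V -> R) :
  (forall j, (j <= m)%N -> beta j < beta m.+1) ->
  (forall i j, (i <= j <= m)%N -> beta i <= beta j) ->
  (forall j, (j <= m)%N ->
     rho * (beta m.+1 - beta j) <= alpha m.+1 - alpha j) ->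
  alpha m.+1 - alpha m = rho * (beta m.+1 - beta m) ->
  0 <= rho ->
  (forall j u, (j < m.+1)%N -> Phi j u <= Phi j.+1 u) ->
  (forall j, (j <= m.+1)%N ->
     alpha j <= dot p (Phi j) /\ dot q (Phi j) <= beta j) ->
  dot p (Phi 0%N) = alpha 0%N -> dot q (Phi 0%N) = beta 0%N ->
  dot p (Phi m.+1) = alpha m.+1 -> dot q (Phi m.+1) = beta m.+1 ->
  exists Phi' : nat -> V -> R, [/\ Phi' 0%N =1 Phi 0%N,
    (forall j u, (j < m)%N -> Phi' j u <= Phi' j.+1 u),
    (forall u, Phi' m u <= Phi m.+1 u),
    (forall j, (j <= m)%N ->
       alpha j <= dot p (Phi' j) /\ dot q (Phi' j) <= beta j) &
    dot p (Phi' m) = alpha m /\ dot q (Phi' m) = beta m].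
Proof.
move=> beta_lt beta_mono conc slope rho0 nPhi nw p0 q0 pm qm.
(* With a single edge, test [0] is already on the chain and nothing is cut. *)
have [m0|m_gt0] := posnP m.
  subst m; exists Phi; split=> // [u|j j0]; first exact: nPhi.
  by apply: nw; apply: leq_trans j0 _.
(* Signed height of [(dot q phi, dot p phi)] above the cutting line; it is affine in [phi]. *)
pose h phi := dot p phi - alpha m.+1 + rho * (beta m.+1 - dot q phi).
have h_mix t phi psi : h (mix t phi psi) = (1 - t) * h phi + t * h psi.
  by rewrite /h !dot_mix; ring.
(* Test [m] lies north-west of chain point [m], which is on the line, and [rho] is nonnegative. *)
have ex_i : exists i, 0 <= h (Phi i.+1).
  exists m.-1; rewrite prednK //.
  have [pm' qm'] := nw _ (leqnSn m).
  rewrite /h; nra.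
have [i hi i_min] := find_ex_minn ex_i.
have im : (i < m)%N.
  have := i_min m.-1; rewrite prednK // => le_i.
  rewrite -[X in (_ < X)%N](prednK m_gt0) ltnS; apply: le_i.
  have [pm' qm'] := nw _ (leqnSn m).
  rewrite /h; nra.
(* For [i = 0], the test sits at chain point [0], below the line by concavity; otherwise [i] is
   minimal. *)
have hi0 : h (Phi i) <= 0.
  case: i i_min {hi} im => [|i] i_min im.
    by have := conc 0%N isT; rewrite /h p0 q0; lra.
  by rewrite leNgt; apply/negP => /ltW/i_min; rewrite ltnn.
have [t [t0 t1 ht]] := convex_zero hi0 hi.
pose Psi := mix t (Phi i) (Phi i.+1).
have hPsi : h Psi = 0 by rewrite h_mix.
pose s := dot q Psi.
have le_s : s <= beta i.+1.
  rewrite /s dot_mix.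
  have [_ qi] := nw i (leqW (ltnW im)).
  have [_ qi1] := nw i.+1 (leqW im).
  have bi := beta_mono i i.+1; rewrite leqnSn im in bi; move: (bi isT) => {}bi.
  nra.
have nested := nested_le nPhi.
have le_iPsi u : Phi i u <= Psi u.
  by apply: mix_ge => //; apply: nPhi; apply: ltnW.
have le_Psi u : Psi u <= Phi m.+1 u.
  apply: (@le_trans _ _ (Phi i.+1 u)).
    by apply: mix_le => //; apply: nPhi; apply: ltnW.
  by apply: nested; rewrite leqnn andbT ltnS ltnW.
(* The weight that gives the mixture of [Psi] and [Phi m.+1] the [q]-value [beta j]. For [j > i] it
   is nonnegative thanks to [le_s]. *)
pose mu j := (beta j - s) / (beta m.+1 - s).
have ds : 0 < beta m.+1 - s.
  by have := beta_lt i.+1 im; lra.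
have mu_ge0 j : (i < j <= m)%N -> 0 <= mu j.
  move=> ij; apply: divr_ge0; last exact: ltW.
  by have := beta_mono _ _ ij; lra.
have mu_le1 j : (j <= m)%N -> mu j <= 1.
  by move=> jm; rewrite ler_pdivrMr // mul1r; have := beta_lt j jm; lra.
have mu_homo j k : (j <= k <= m)%N -> mu j <= mu k.
  by move=> jk; rewrite ler_pM2r ?invr_gt0 //; have := beta_mono _ _ jk; lra.
pose Phi' j := if (j <= i)%N then Phi j else mix (mu j) Psi (Phi m.+1).
have q' j : (i < j)%N -> dot q (Phi' j) = beta j.
  rewrite /Phi' ltnNge => /negbTE ->; rewrite dot_mix qm -/s /mu.
  by field; rewrite gt_eqF.
have p' j : (i < j)%N ->
    dot p (Phi' j) = alpha m.+1 - rho * (beta m.+1 - beta j).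
  (* Both ends of the mixture have height zero, so its [q]-value determines its [p]-value. *)
  move=> ij; have qj := q' j ij.
  have hj : h (Phi' j) = 0.
    rewrite /Phi' leqNgt ij /= h_mix hPsi /h pm qm; ring.
  by move: hj; rewrite /h qj => hj; lra.
exists Phi'; split=> //.
- move=> j u jm; rewrite /Phi'; have [ji|ij] := leqP j i; last first.
    rewrite leqNgt (leq_trans ij) //=; apply: mix_homo => //.
    by apply: mu_homo; rewrite leqnSn.
  have [ji1|ij1] := leqP j.+1 i; first by apply: nPhi; apply: ltnW.
  (* At the junction of old and new tests, [Psi] separates the two. *)
  have -> : j = i by apply/eqP; rewrite eqn_leq ji.
  apply: le_trans (le_iPsi u) _; apply: mix_ge => //.
  by apply: mu_ge0; rewrite ltnSn.
- move=> u; rewrite /Phi' leqNgt im /=; apply: mix_le => //.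
  exact: mu_le1.
- move=> j jm; have [ji|ij] := leqP j i.
    by rewrite /Phi' ji; apply: nw; apply: leqW.
  by rewrite p' // q' //; split=> //; have := conc j jm; lra.
- by rewrite p' // q' //; split=> //; lra.
Qed.

(** Induction from the top: a cut along the last edge makes test [m] exact, and the first [m] edges
    then form a shorter instance. *)
Lemma interpolate_tests (R : realType) (V : finType) (p q : V -> R)
    (alpha beta rho : nat -> R) (m : nat) (Phi : nat -> V -> R) :
  (forall i, (i < m)%N -> beta i < beta i.+1) ->
  (forall i j, (i <= j < m)%N ->
     rho j * (beta j.+1 - beta i) <= alpha j.+1 - alpha i) ->
  (forall i, (i < m)%N ->
     alpha i.+1 - alpha i = rho i * (beta i.+1 - beta i)) ->
  (forall i, (i < m)%N -> 0 <= rho i) ->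
  (forall j u, (j < m)%N -> Phi j u <= Phi j.+1 u) ->
  (forall j, (j <= m)%N ->
     alpha j <= dot p (Phi j) /\ dot q (Phi j) <= beta j) ->
  dot p (Phi 0%N) = alpha 0%N -> dot q (Phi 0%N) = beta 0%N ->
  dot p (Phi m) = alpha m -> dot q (Phi m) = beta m ->
  exists Phi' : nat -> V -> R, [/\ Phi' 0%N =1 Phi 0%N, Phi' m =1 Phi m,
    (forall j u, (j < m)%N -> Phi' j u <= Phi' j.+1 u) &
    (forall j, (j <= m)%N ->
       dot p (Phi' j) = alpha j /\ dot q (Phi' j) = beta j)].
Proof.
elim: m Phi => [|m IH] Phi beta_lt conc slope rho0 nPhi nw p0 q0 pm qm.
  by exists Phi; split=> // j; rewrite leqn0 => /eqP->.
(* A real sequence is treated as a family of functions on [unit]. *)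
have beta_mono i j : (i <= j <= m.+1)%N -> beta i <= beta j.
  move=> ij; apply: (@nested_le _ unit (fun k _ => beta k) m.+1 _ i j tt ij).
  by move=> k _ /beta_lt/ltW.
have [|||||Phi1 [Phi10 nPhi1 Phi1m nw1 [p1 q1]]] :=
  @cut_tests _ _ p q alpha beta (rho m) m Phi _ _ _ _ _ nPhi nw p0 q0 pm qm.
- move=> j jm; apply: le_lt_trans (beta_lt m (ltnSn m)).
  by apply: beta_mono; rewrite jm leqnSn.
- by move=> i j /andP[ij jm]; apply: beta_mono; rewrite ij leqW.
- by move=> j jm; apply: conc; rewrite jm ltnSn.
- exact: slope.
- exact: rho0.
have dot10 r : dot r (Phi1 0%N) = dot r (Phi 0%N).
  by apply: eq_bigr => u _; rewrite Phi10.
have [||||||||||Phi2 [Phi20 Phi2m nPhi2 eq2]] := IH Phi1; rewrite ?dot10 //.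
- by move=> i im; apply: beta_lt; apply: ltnW.
- by move=> i j /andP[ij jm]; apply: conc; rewrite ij leqW.
- by move=> i im; apply: slope; apply: ltnW.
- by move=> i im; apply: rho0; apply: ltnW.
exists (fun j => if (j <= m)%N then Phi2 j else Phi m.+1); split.
- by move=> u; rewrite /= Phi20 Phi10.
- by move=> u; rewrite ltnn.
- move=> j u; rewrite ltnS => jm; rewrite jm.
  have [jm1|] := ltnP j m; first exact: nPhi2.
  by move=> mj; have -> : j = m by [apply/eqP; rewrite eqn_leq jm]; rewrite Phi2m.
- move=> j; rewrite leq_eqVlt => /orP[/eqP->|]; first by rewrite ltnn.
  by rewrite ltnS => jm; rewrite jm; apply: eq2.
Qed.

(** * From nested tests to a channel *)

(** The tests give each level its correct mass. Resampling by [Q] inside a level then recovers [Q],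
    and also [P], since cross-multiplication makes [P] proportional to [Q] there. *)
Lemma tests_channel (R : realType) (V : finType) (P Q P' Q' : fdist R V)
    (lvl : V -> nat) (n : nat) (Phi : nat -> V -> R) :
  (forall v, (lvl v < n)%N) ->
  (forall i, (i < n)%N -> exists v, lvl v = i) ->
  (forall v, 0 < Q v) ->
  (forall u v, lvl u = lvl v -> P u * Q v = P v * Q u) ->
  (forall u, Phi 0%N u = 0) -> (forall u, Phi n u = 1) ->
  (forall j u, (j < n)%N -> Phi j u <= Phi j.+1 u) ->
  (forall j, (j <= n)%N ->
     dot P' (Phi j) = vsum P [set v | (lvl v < j)%N] /\
     dot Q' (Phi j) = vsum Q [set v | (lvl v < j)%N]) ->
  exists K : channel R V V, channel_out K P' = P /\ channel_out K Q' = Q.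
Proof.
move=> lvl_lt lvl_onto Q_gt0 prop Phi0 Phin nPhi ePhi.
pose mass (p : V -> R) i := \sum_(v | lvl v == i) p v.
have massE (p : {ffun V -> R}) i : mass p i =
    vsum p [set v | (lvl v < i.+1)%N] - vsum p [set v | (lvl v < i)%N].
  rewrite /mass /vsum; apply/eqP; rewrite eq_sym subr_eq; apply/eqP.
  rewrite (bigID (fun v => lvl v == i)) /=; congr (_ + _); apply: eq_bigl => v.
    by rewrite inE ltnS; case: eqVneq => [->|_]; rewrite ?leqnn ?andbF.
  by rewrite !inE ltnS ltn_neqAle andbC.
have mass_gt0 i : (i < n)%N -> 0 < mass Q i.
  move=> /lvl_onto[v lv]; rewrite /mass (bigD1 v) /=; last exact/eqP.
  by apply: ltr_wpDr => //; apply: sumr_ge0 => u _; apply: ltW.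
pose K u := [ffun v =>
  (Phi (lvl v).+1 u - Phi (lvl v) u) * (Q v / mass Q (lvl v))].
have K_fdist u : is_fdist (K u).
  apply/andP; split.
    apply/forallP => v; rewrite ffunE; apply: mulr_ge0.
      by rewrite subr_ge0 nPhi.
    by apply: divr_ge0; apply: ltW => //; apply: mass_gt0.
  (* Grouped by level, the weights [Q v / mass Q i] sum to one and the increments of [Phi]
     telescope. *)
  under eq_bigr do rewrite ffunE.
  rewrite (partition_big (fun v => Ordinal (lvl_lt v)) xpredT) //=.
  rewrite (eq_bigr (fun i : 'I_n => Phi i.+1 u - Phi i u)); last first.
    move=> i _; rewrite (eq_bigr (fun v =>
        (Phi i.+1 u - Phi i u) / mass Q i * Q v)); last first.
      by move=> v /eqP <- /=; rewrite mulrA mulrAC.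
    rewrite -mulr_sumr (eq_bigl (fun v => lvl v == i)) //.
    by rewrite -/(mass Q i) divfK // gt_eqF // mass_gt0.
  rewrite -(big_mkord xpredT (fun i => Phi i.+1 u - Phi i u)).
  by rewrite telescope_sumr // Phin Phi0 subr0.
have out (p p' : fdist R V) :
    (forall j, (j <= n)%N -> dot p' (Phi j) = vsum p [set v | (lvl v < j)%N]) ->
    (forall u v, lvl u = lvl v -> p u * Q v = p v * Q u) ->
    channel_out (fun u => FDist (K_fdist u)) p' = p.
  move=> ep' pQ; apply: val_inj; apply/ffunP => v; rewrite ffunE /=.
  rewrite (eq_bigr (fun u => (p' u * Phi (lvl v).+1 u - p' u * Phi (lvl v) u)
      * (Q v / mass Q (lvl v)))); last first.
    by move=> u _; rewrite ffunE mulrA mulrBr.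
  (* The total [p']-mass sent to the level of [v] becomes [mass p (lvl v)]. *)
  rewrite -mulr_suml big_split /= sumrN -/(dot p' _) -/(dot p' _).
  rewrite !ep' ?(ltnW (lvl_lt v)) // -massE mulrA.
  apply: (@mulIf _ (mass Q (lvl v))); first by rewrite gt_eqF // mass_gt0.
  rewrite divfK ?gt_eqF ?mass_gt0 // /mass mulr_suml mulr_sumr.
  by apply: eq_bigr => u /eqP lu; apply: pQ.
exists (fun u => FDist (K_fdist u)); split; apply: out => //.
- by move=> j /ePhi[].
- by move=> j /ePhi[].
- by move=> u v _; rewrite mulrC.
Qed.

(** * Level sets of [x / y] and comparison of allocations *)

Theorem theorem1p7 (R : realType) (V : finType) (f g : {set V} -> R)
    (hfg : dual_modular f g) (fV : f [set: V] = 1) (gV : g [set: V] = 1)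
    (x y : {ffun V -> R}) (hx : base_ge f x) (hy : base_le g y)
    (hmax : locally_maximin f g x y)
    (D : dist_functional R) (Ddiv : is_divergence D) (Ddpi : data_processing D)
    (x' y' : {ffun V -> R}) (hx' : base_ge f x') (hy' : base_le g y') :
  (D V (base_ge_fdist fV hx) (base_le_fdist gV hy)
     <= D V (base_ge_fdist fV hx') (base_le_fdist gV hy'))%E.
Proof.
have y_gt0 := base_le_gt0 (dual_modular_g_mono hfg) hy.
have [_ _ tight] := hmax.
pose r v := x v / y v.
have xE v : x v = r v * y v by rewrite /r divfK // gt_eqF.
have r_ge0 v : 0 <= r v.
  by apply: divr_ge0; [apply: base_ge_ge0 hx _ | apply: ltW].
(* Distinct ratios in decreasing order, so that initial segments of levels are the sets
   [level_set x y rho]. *)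
pose t := sort >=%R (undup [seq r v | v <- enum V]).
have t_sorted : sorted >=%R t by apply: sort_sorted => a b; apply: le_total.
have t_uniq : uniq t by rewrite sort_uniq undup_uniq.
have ge_tr : transitive (>=%R : rel R) by move=> a b c /= ba cb; apply: le_trans ba.
have ge_refl : reflexive (>=%R : rel R) by move=> a /=.
have mem_t v : r v \in t.
  by rewrite mem_sort mem_undup; apply: map_f; rewrite mem_enum.
pose lvl v := index (r v) t.
pose n := size t.
pose rho i := nth 0 t i.
have lvl_lt v : (lvl v < n)%N by rewrite index_mem.
have rho_lvl v : rho (lvl v) = r v by rewrite /rho nth_index.
have lvl_onto i : (i < n)%N -> exists v, lvl v = i.
  move=> i_lt; have := mem_nth 0 i_lt.
  rewrite {1}/t mem_sort mem_undup => /mapP[v _ ev]; exists v.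
  by rewrite /lvl -ev index_uniq.
have rho_homo i j : (i <= j < n)%N -> rho j <= rho i.
  move=> /andP[ij j_lt]; apply: (sorted_leq_nth ge_tr ge_refl 0 t_sorted i j) => //.
  by rewrite inE; apply: leq_ltn_trans j_lt.
have lvl_le i v : (i < n)%N -> (lvl v <= i)%N = (rho i <= r v).
  move=> i_lt; apply/idP/idP => [le_i|].
    by rewrite -(rho_lvl v) rho_homo ?le_i.
  apply: contraLR; rewrite -ltnNge -ltNge => lt_v.
  rewrite lt_neqAle -(rho_lvl v); apply/andP; split.
    by rewrite /rho nth_uniq // gtn_eqF.
  by rewrite rho_homo // ltnW /=.
pose T i := [set v | (lvl v < i)%N].
have T0 : T 0%N = set0 by apply/setP => v; rewrite !inE.
have Tn : T n = setT by apply/setP => v; rewrite !inE lvl_lt.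
have TS i : (i < n)%N -> T i.+1 = level_set x y (rho i).
  by move=> i_lt; apply/setP => v; rewrite !inE ltnS lvl_le.
have rho_ge0 i : (i < n)%N -> 0 <= rho i.
  by move=> /lvl_onto[v <-]; rewrite rho_lvl.
have total (p : {ffun V -> R}) : base_ge f p \/ base_le g p -> vsum p setT = 1.
  by case=> [/base_ge_total->|/base_le_total->].
have dominated j : (j <= n)%N ->
    vsum x (T j) <= vsum x' (T j) /\ vsum y' (T j) <= vsum y (T j).
  case: j => [|j j_lt]; first by rewrite T0 /vsum !big_set0.
  have [rho_gt0|] := ltP 0 (rho j).
    rewrite TS //; have [-> ->] := tight _ rho_gt0.
    by split; [apply: base_ge_bound hx' _ | apply: base_le_bound hy' _].
  (* Tightness is given only for positive thresholds; at a nonpositive one the level set is all of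
     [V], where all masses are [1]. *)
  move=> rho_le0; suff -> : T j.+1 = setT.
    by rewrite !total; auto.
  apply/setP => v; rewrite TS // !inE; exact: le_trans rho_le0 (r_ge0 v).
have vsumB (p : {ffun V -> R}) i j : (i <= j)%N ->
    vsum p (T j) - vsum p (T i) = \sum_(v | (i <= lvl v < j)%N) p v.
  move=> ij; apply/eqP; rewrite subr_eq addrC; apply/eqP.
  rewrite /vsum (bigID (fun v => (lvl v < i)%N)) /=.
  congr (_ + _); apply: eq_bigl => v; rewrite !inE.
    by apply: andb_idl => /leq_trans; apply.
  by rewrite -leqNgt andbC.
pose Psi j (u : V) : R := (u \in T j)%:R.
have [||||||||||Phi [Phi0 Phin nPhi ePhi]] := @interpolate_tests _ _ x' y'
  (fun j => vsum x (T j)) (fun j => vsum y (T j)) rho n Psi.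
(* Each level is inhabited and [y] is positive. *)
- move=> i i_lt; rewrite -subr_gt0 vsumB //.
  have [v lv] := lvl_onto i i_lt.
  rewrite (bigD1 v) /=; last by rewrite lv leqnn ltnSn.
  by apply: ltr_wpDr => //; apply: sumr_ge0 => u _; apply: ltW.
(* Concavity: the ratio is at least [rho j] on all levels up to [j]. *)
- move=> i j /andP[ij j_lt]; rewrite !vsumB ?leqW // mulr_sumr.
  apply: ler_sum => v /andP[_ lv]; rewrite xE ler_pM2r //.
  by rewrite -lvl_le.
- move=> i i_lt; rewrite !vsumB // mulr_sumr; apply: eq_bigr => v.
  by rewrite ltnS -eqn_leq => /eqP->; rewrite rho_lvl.
- exact: rho_ge0.
- move=> j u _; rewrite /Psi ler_nat !inE.
  by case: ltnP => // /ltnW lj; rewrite ltnS lj.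
- by move=> j jn; rewrite !dot_indicator; apply: dominated.
- by rewrite dot_indicator T0 /vsum !big_set0.
- by rewrite dot_indicator T0 /vsum !big_set0.
- by rewrite dot_indicator Tn !total; auto.
- by rewrite dot_indicator Tn !total; auto.
(* Rewriting backwards turns [(x, y)] in the goal into the outputs of [K] on [(x', y')]. *)
have [||||||||K [<- <-]] := @tests_channel _ _ (base_ge_fdist fV hx)
  (base_le_fdist gV hy) (base_ge_fdist fV hx') (base_le_fdist gV hy') lvl n Phi.
- exact: lvl_lt.
- exact: lvl_onto.
- exact: y_gt0.
- by move=> u v luv; rewrite /= !xE -!rho_lvl luv mulrAC.
- by move=> u; rewrite Phi0 /Psi T0 inE.
- by move=> u; rewrite Phin /Psi Tn inE.
- exact: nPhi.
- exact: ePhi.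
exact: Ddpi.
Qed.
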